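(* Let $n>3$ be an integer and let $a,b,c\in\mathbb{C}$ with $abc\neq 0$. Let $f(x)=x^n+ax^2+bx+c$, and put $e_1=-\frac{(n-1)b}{(n-2)a}$ and $e_2=\frac{nc}{(n-2)a}$. Then \begin{align*} \Delta(f)=&(-1)^{\frac{n(n-1)}{2}}n^{-1}(n-2)^{n-1}a^{n-1}\\ &\cdot\Bigg[n^2e_2^{n-1}+4a^2e_2+2abe_1+b^2+\left(1+(-1)^{n-1}\right)bn\left(\left(\frac{e_1}{2}\right)^2-e_2\right)^{\frac{n-1}{2}}\\ &\quad+n\sum_{i=0}^{\lfloor\frac{n-2}{2}\rfloor}\left(4ae_2+\frac{n-1}{n-1-2i}be_1\right)\binom{n-2}{2i}\left(\frac{e_1}{2}\right)^{n-2-2i}\left(\left(\frac{e_1}{2}\right)^2-e_2\right)^{i}\Bigg]. \end{align*}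
   Context: For a polynomial $f(x)=a_nx^n+\dots+a_0\in\mathbb{C}[x]$ of degree $n\geq 1$ with roots $\xi_1,\dots,\xi_n\in\mathbb{C}$ (listed with multiplicity), the discriminant is $\Delta(f)=a_n^{2n-2}\prod_{1\leq i<j\leq n}(\xi_i-\xi_j)^2$. Conventions: $z^0=1$ for all $z\in\mathbb{C}$ (including $z=0$); the term with coefficient $1+(-1)^{n-1}$ is zero when $n$ is even (so the half-integer power is irrelevant in that case). *)

(* Defs.v *)
From HB Require Import structures.
From mathcomp Require Import all_boot all_order all_algebra.
From mathcomp Require Import reals complex.

Set Implicit Arguments.
Unset Strict Implicit.
Unset Printing Implicit Defensive.
Import Order.TTheory GRing.Theory Num.Theory.
Local Open Scope ring_scope.

(* The roots with multiplicity, in an arbitrary order; the order is irrelevant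
   to [discriminant], where each difference occurs squared. *)
Definition roots (F : closedFieldType) (p : {poly F}) : seq F :=
  sval (closed_field_poly_normal p).

Lemma rootsE (F : closedFieldType) (p : {poly F}) :
  p = lead_coef p *: \prod_(z <- roots p) ('X - z%:P).
Proof. exact: svalP (closed_field_poly_normal p). Qed.

Lemma size_roots (F : closedFieldType) (p : {poly F}) :
  p != 0 -> size (roots p) = (size p).-1.
Proof.
move=> p0; rewrite [in RHS](rootsE p) size_scale ?lead_coef_eq0 //.
by rewrite size_prod_XsubC.
Qed.

(* Meaningful for polynomials of degree at least 1. *)
Definition discriminant (F : closedFieldType) (p : {poly F}) : F :=
  let n := (size p).-1 in
  lead_coef p ^+ (2 * n - 2) *
  \prod_(i < n) \prod_(j < n | (i < j)%N) ((roots p)`_i - (roots p)`_j) ^+ 2.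

(* Main.v *)
Require Import Defs.
From HB Require Import structures.
From mathcomp Require Import all_boot all_order all_algebra.
From mathcomp Require Import reals complex.
From mathcomp Require Import ring zify.

Set Implicit Arguments.
Unset Strict Implicit.
Unset Printing Implicit Defensive.
Import Order.TTheory GRing.Theory Num.Theory.
Local Open Scope ring_scope.

(** For a monic [f] of degree [n], the discriminant is
    [(-1)^(n(n-1)/2) * \prod_i f'(xi_i)] over the roots [xi_i].  At a root,
    [xi f'(xi) = - (n-2) a (xi^2 - e1 xi + e2) = - (n-2) a (xi - r) (xi - s)],
    so the product is [(n-2)^n a^n f(r) f(s) / c].  Since [r] is a zero of the
    quadratic, [n f(r) = r (n r^(n-1) + 2 a r + b)], and likewise for [s];
    expanding the product leaves the power sums [r^m + s^m] for [m = n-2, n-1],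
    which the binomial theorem evaluates from [r, s = e1/2 +- d] with
    [d^2 = (e1/2)^2 - e2]. *)


Lemma prodN1_ltn (F : comNzRingType) (n : nat) :
  \prod_(i < n) \prod_(j < n | (i < j)%N) (-1 : F) = (-1) ^+ 'C(n, 2).
Proof.
rewrite (exchange_big_dep xpredT) //= -bin2_sum big_mkord -prodrXr.
apply: eq_bigr => j _.
by rewrite -(big_ord_widen n (fun=> -1 : F) (ltnW (ltn_ord j))) prodr_const card_ord.
Qed.

(** The pair [i < j] occurs on the left as both [x i - x j] and [x j - x i], whose product is minus
    the square; there are ['C(n, 2)] such pairs. *)
Lemma prod_neq_diff (F : comNzRingType) (n : nat) (x : nat -> F) :
  \prod_(i < n) \prod_(j < n | j != i) (x i - x j) =
  (-1) ^+ 'C(n, 2) * \prod_(i < n) \prod_(j < n | (i < j)%N) (x i - x j) ^+ 2.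
Proof.
have split_i (i : 'I_n) : \prod_(j < n | j != i) (x i - x j) =
    \prod_(j < n | (i < j)%N) (x i - x j) * \prod_(j < n | (j < i)%N) (x i - x j).
  rewrite (bigID (fun j : 'I_n => (i < j)%N)) /=.
  by congr (_ * _); apply: eq_bigl => j; rewrite -val_eqE /=; case: ltngtP.
rewrite (eq_bigr _ (fun i _ => split_i i)) big_split /=.
(* Swapping the indices in the half with [j < i] makes both halves range over the same pairs. *)
rewrite [X in _ * X](exchange_big_dep xpredT) //= -prodN1_ltn -!big_split /=.
apply: eq_bigr => i _; rewrite -!big_split /=.
by apply: eq_bigr => j _; ring.
Qed.

Lemma deriv_prod_XsubC_root (F : comNzRingType) (n : nat) (x : nat -> F) (i : 'I_n) :
  (\prod_(j < n) ('X - (x j)%:P))^`().[x i] = \prod_(j < n | j != i) (x i - x j).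
Proof.
rewrite (bigD1 i) //= derivM derivXsubC mul1r hornerD hornerM hornerXsubC.
rewrite subrr mul0r addr0 horner_prod.
by apply: eq_bigr => j _; rewrite hornerXsubC.
Qed.

Lemma monic_prod_roots (F : closedFieldType) (p : {poly F}) :
  p \is monic -> p = \prod_(z <- Defs.roots p) ('X - z%:P).
Proof. by move=> /monicP p1; rewrite {1}(rootsE p) p1 scale1r. Qed.

(** Indexing by position in the list of roots, not by value, treats repeated roots uniformly. *)
Lemma monic_discriminant (F : closedFieldType) (p : {poly F}) :
  p \is monic ->
  discriminant p = (-1) ^+ 'C((size p).-1, 2) * \prod_(z <- Defs.roots p) p^`().[z].
Proof.
move=> p1; rewrite /discriminant (monicP p1) expr1n mul1r.
have sz := size_roots (monic_neq0 p1).
rewrite (big_nth 0) sz big_mkord.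
have -> : \prod_(i < (size p).-1) p^`().[(Defs.roots p)`_i] =
    \prod_(i < (size p).-1) \prod_(j < (size p).-1 | j != i)
      ((Defs.roots p)`_i - (Defs.roots p)`_j).
  apply: eq_bigr => i _.
  rewrite -(deriv_prod_XsubC_root (fun k => (Defs.roots p)`_k) i).
  by rewrite {1}(monic_prod_roots p1) (big_nth 0) sz big_mkord.
by rewrite (prod_neq_diff _ (fun k => (Defs.roots p)`_k)) mulrA -exprMn mulrNN mulr1 expr1n mul1r.
Qed.

Lemma prod_roots_subr (F : closedFieldType) (p : {poly F}) (r : F) :
  p \is monic -> \prod_(z <- Defs.roots p) (z - r) = (-1) ^+ (size p).-1 * p.[r].
Proof.
move=> p1; rewrite {3}(monic_prod_roots p1) horner_prod.
rewrite -(size_roots (monic_neq0 p1)).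
elim: (Defs.roots p) => [|z s IH]; first by rewrite !big_nil mulr1.
by rewrite !big_cons IH hornerXsubC /= exprS; ring.
Qed.

Lemma sum_even_terms (V : nmodType) (G : nat -> V) (k : nat) :
  (forall i, odd i -> G i = 0) -> \sum_(i < 2 * k) G i = \sum_(j < k) G (2 * j)%N.
Proof.
move=> G_odd; elim: k => [|k IH]; first by rewrite muln0 !big_ord0.
rewrite mulnS !addSn add0n !big_ord_recr /= IH (G_odd (2 * k).+1) ?addr0 //.
by rewrite /= mul2n odd_double.
Qed.

Lemma exprD_plus_exprB (F : comNzRingType) (h d : F) (m : nat) :
  (h + d) ^+ m + (h - d) ^+ m =
  2 * \sum_(0 <= i < (m %/ 2).+1) 'C(m, 2 * i)%:R * h ^+ (m - 2 * i) * (d ^+ 2) ^+ i.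
Proof.
pose G i := (1 + (-1) ^+ i) * ('C(m, i)%:R * h ^+ (m - i) * d ^+ i) : F.
have G_odd i : odd i -> G i = 0.
  by move=> i_odd; rewrite /G -signr_odd i_odd expr1 subrr mul0r.
(* The sum over [i <= m] is padded to an even number of terms; for even [m] the extra index [m + 1]
   has a zero binomial coefficient. *)
have le_m : (m.+1 <= 2 * (m %/ 2).+1)%N by lia.
have -> : (h + d) ^+ m + (h - d) ^+ m = \sum_(i < m.+1) G i.
  rewrite exprDn exprBn -big_split; apply: eq_bigr => i _ /=.
  by rewrite -mulrnDl -mulr_natl /G; ring.
rewrite (big_ord_widen _ G le_m) big_mkcond /=.
rewrite (eq_bigr (fun i : 'I_ _ => G i)) => [|i _]; last first.
  by case: ltnP => // m_lt_i; rewrite /G bin_small // !mul0r mulr0.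
rewrite sum_even_terms // big_mkord mulr_sumr; apply: eq_bigr => i _.
by rewrite /G !exprM sqrrN !expr1n.
Qed.

(** Each term of [exprD_plus_exprB] with [2 * i < m] yields a factor [h] through
    [(m - 2i) C(m, 2i) = m C(m-1, 2i)]. For even [m] the top term [2 i = m] has no such factor and
    is split off; the coefficient [1 + (-1) ^+ m] records it. *)
Lemma power_sum_pred (F : numFieldType) (h d : F) (m : nat) : (0 < m)%N ->
  (h + d) ^+ m + (h - d) ^+ m =
  (1 + (-1) ^+ m) * (d ^+ 2) ^+ (m %/ 2)
  + 2 * h * \sum_(0 <= i < (m.-1 %/ 2).+1)
      m%:R / (m%:R - 2 * i%:R) * 'C(m.-1, 2 * i)%:R * h ^+ (m.-1 - 2 * i) * (d ^+ 2) ^+ i.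
Proof.
move=> m_gt0; rewrite exprD_plus_exprB.
set S := \sum_(0 <= i < (m.-1 %/ 2).+1) _.
have hS : h * S = \sum_(0 <= i < (m.-1 %/ 2).+1)
    'C(m, 2 * i)%:R * h ^+ (m - 2 * i) * (d ^+ 2) ^+ i.
  rewrite mulr_sumr; apply: eq_big_nat => i /andP[_ lt_i].
  have lt_2i : (2 * i < m)%N by lia.
  have -> : m%:R - 2 * i%:R = (m - 2 * i)%:R :> F by rewrite natrB 1?ltnW // natrM.
  have -> : 'C(m, 2 * i)%:R = m%:R / (m - 2 * i)%:R * 'C(m.-1, 2 * i)%:R :> F.
    apply: (@mulfI _ (m - 2 * i)%:R); first by rewrite pnatr_eq0; lia.
    rewrite -natrM -mul_bin_down natrM [RHS]mulrA [in RHS]mulrCA mulfV ?mulr1 //.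
    by rewrite pnatr_eq0; lia.
  have -> : (m - 2 * i = (m.-1 - 2 * i).+1)%N by lia.
  by rewrite (exprS h) [LHS]mulrA [in LHS]mulrCA.
rewrite -(mulrA 2 h) hS -(signr_odd _ m).
case: (boolP (odd m)) => m_par.
  have -> : (m.-1 %/ 2 = m %/ 2)%N by lia.
  by rewrite expr1 subrr mul0r add0r.
have -> : ((m.-1 %/ 2).+1 = m %/ 2)%N by lia.
have m2 : (2 * (m %/ 2) = m)%N by lia.
by rewrite big_nat_recr //= m2 binn subnn !expr0; ring.
Qed.

Lemma quadrinomial_values_prod (F : fieldType) (m : nat) (n a b c r s : F) :
  (n - 2) * a * (r + s) = - ((n - 1) * b) ->
  (n - 2) * a * (r * s) = n * c ->
  n ^+ 2 * ((r ^+ m.+2 + a * r ^+ 2 + b * r + c) * (s ^+ m.+2 + a * s ^+ 2 + b * s + c)) =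
  r * s * (n ^+ 2 * (r * s) ^+ m.+1 + 4 * a ^+ 2 * (r * s) + 2 * a * b * (r + s) + b ^+ 2
    + 2 * a * n * (r * s) * (r ^+ m + s ^+ m) + b * n * (r ^+ m.+1 + s ^+ m.+1)).
Proof.
move=> sumE prodE.
have value x : (x - r) * (x - s) = 0 ->
    n * (x ^+ m.+2 + a * x ^+ 2 + b * x + c) = x * (n * x ^+ m.+1 + 2 * a * x + b).
  move=> x_root; have : (n - 2) * a * ((x - r) * (x - s)) = 0 by rewrite x_root mulr0.
  have -> : (n - 2) * a * ((x - r) * (x - s)) =
    (n - 2) * a * x ^+ 2 - (n - 2) * a * (r + s) * x + (n - 2) * a * (r * s) by ring.
  rewrite sumE prodE => quadratic.
  (* The two sides differ by exactly [(n-2) a x^2 + (n-1) b x + n c]. *)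
  apply/eqP; rewrite -subr_eq0 -quadratic; apply/eqP.
  by rewrite !exprS; ring.
rewrite expr2 mulrACA.
rewrite value ?subrr ?mul0r // value ?subrr ?mulr0 //.
by rewrite exprMn !exprS; ring.
Qed.

Lemma size_quadrinomial (F : nzRingType) (n : nat) (a b c : F) :
  (2 < n)%N -> size ('X^n + a *: 'X^2 + b *: 'X + c%:P) = n.+1.
Proof.
move=> n_gt2; rewrite -!addrA size_polyDl ?size_polyXn // ltnS.
apply: leq_trans n_gt2; apply: leq_trans (size_polyD _ _) _; rewrite geq_max.
rewrite (leq_trans (size_scale_leq _ _)) ?size_polyXn //=.
apply: leq_trans (size_polyD _ _) _; rewrite geq_max.
rewrite (leq_trans (size_scale_leq _ _)) ?size_polyX //=.
by rewrite (leq_trans (size_polyC_leq1 _)).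
Qed.

Lemma monic_quadrinomial (F : nzRingType) (n : nat) (a b c : F) :
  (2 < n)%N -> 'X^n + a *: 'X^2 + b *: 'X + c%:P \is monic.
Proof.
move=> n_gt2; rewrite monicE lead_coefE size_quadrinomial //= !coefE eqxx.
by rewrite !gtn_eqF ?(ltnW n_gt2) ?(ltnW (ltnW n_gt2)) // !mulr0 !addr0.
Qed.

(** The factor [c], up to sign the product of the roots, turns each [f'(z)] into [z f'(z)], from
    which [z^n] is eliminated by [f(z) = 0]. *)
Lemma prod_deriv_quadrinomial (F : closedFieldType) (n : nat) (a b c r s : F) :
  let f : {poly F} := 'X^n + a *: 'X^2 + b *: 'X + c%:P in
  (2 < n)%N -> (n%:R - 2) * a * (r + s) = - ((n%:R - 1) * b) ->
  (n%:R - 2) * a * (r * s) = n%:R * c ->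
  c * \prod_(z <- Defs.roots f) f^`().[z] = ((n%:R - 2) * a) ^+ n * f.[r] * f.[s].
Proof.
move=> f n_gt2 sumE prodE.
have f_monic : f \is monic by exact: monic_quadrinomial.
have sz : (size f).-1 = n by rewrite size_quadrinomial.
have sz_roots : size (Defs.roots f) = n by rewrite size_roots ?monic_neq0.
have f_val x : f.[x] = x ^+ n + a * x ^+ 2 + b * x + c by rewrite !hornerE.
have prod_roots : \prod_(z <- Defs.roots f) z = (-1) ^+ n * c.
  (* This is [prod_roots_subr] at the point 0, where [f] takes the value [c]. *)
  rewrite -{1}sz -[X in _ * X](_ : f.[0] = c); last first.
    by rewrite f_val expr0n eqn0Ngt (ltn_trans _ n_gt2) //= expr0n !mulr0 !add0r.
  by rewrite -prod_roots_subr //; apply: eq_bigr => z _; rewrite subr0.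
have deriv_root z : root f z ->
    z * f^`().[z] = - ((n%:R - 2) * a) * ((z - r) * (z - s)).
  move=> /rootP; rewrite f_val => fz0.
  have -> : f^`().[z] = n%:R * z ^+ n.-1 + 2 * a * z + b.
    by rewrite !derivE !hornerE hornerMn hornerXn -mulr_natl; ring.
  have -> : - ((n%:R - 2) * a) * ((z - r) * (z - s)) =
      - ((n%:R - 2) * a * z ^+ 2) + (n%:R - 2) * a * (r + s) * z
      - (n%:R - 2) * a * (r * s) by ring.
  (* The difference of the two sides is [n f(z)]. *)
  rewrite sumE prodE; apply/eqP; rewrite -subr_eq0 -(mulr0 n%:R) -fz0; apply/eqP.
  have -> : z ^+ n = z * z ^+ n.-1 by rewrite -exprS prednK // (ltn_trans _ n_gt2).
  by ring.
have : \prod_(z <- Defs.roots f) (z * f^`().[z]) =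
    \prod_(z <- Defs.roots f) (- ((n%:R - 2) * a) * ((z - r) * (z - s))).
  apply: eq_big_seq => z z_root; apply: deriv_root.
  by rewrite (monic_prod_roots f_monic) root_prod_XsubC.
rewrite !big_split /= prod_roots !prod_roots_subr // sz big_const_seq count_predT.
rewrite sz_roots iter_mulr_1 (exprNn (_ * a)) => prods_eq.
(* The sign [(-1)^n] comes once from the product of the roots, once from the constant, and once from
   each of [f(r)] and [f(s)]; inserting it in pairs lets [ring] match both sides. *)
rewrite -[LHS](signrMK n) (mulrA _ c) prods_eq -[in RHS](signrMK n f.[r]).
rewrite -[in RHS](signrMK n f.[s]).
by ring.
Qed.

Theorem theorem3p1 (R : realType) (n : nat) (a b c : R[i])
    (hn : (3 < n)%N) (habc : a * b * c != 0) :
  let f : {poly R[i]} := 'X^n + a *: 'X^2 + b *: 'X + c%:P in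
  let e1 := - (((n%:R - 1) * b) / ((n%:R - 2) * a)) in
  let e2 := (n%:R * c) / ((n%:R - 2) * a) in
  discriminant f =
    (-1) ^+ ((n * (n - 1)) %/ 2) * n%:R^-1 * (n%:R - 2) ^+ (n - 1) * a ^+ (n - 1)
    * (n%:R ^+ 2 * e2 ^+ (n - 1) + 4 * a ^+ 2 * e2 + 2 * a * b * e1 + b ^+ 2
       + (1 + (-1) ^+ (n - 1)) * b * n%:R
         * ((e1 / 2) ^+ 2 - e2) ^+ ((n - 1) %/ 2)
       + n%:R * \sum_(0 <= i < ((n - 2) %/ 2).+1)
           (4 * a * e2 + (n%:R - 1) / (n%:R - 1 - 2 * i%:R) * b * e1)
           * 'C(n - 2, 2 * i)%:R * (e1 / 2) ^+ (n - 2 - 2 * i)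
           * ((e1 / 2) ^+ 2 - e2) ^+ i).
Proof.
move=> f e1 e2.
have /andP[/andP[a0 _] c0] : (a != 0) && (b != 0) && (c != 0) by rewrite -!negb_or -!mulf_eq0.
have N0 : n%:R != 0 :> R[i] by rewrite pnatr_eq0; lia.
have N2 : n%:R - 2 != 0 :> R[i] by rewrite -(natrB _ (ltnW (ltnW hn))) pnatr_eq0; lia.
pose h := e1 / 2; pose d := sqrtC (h ^+ 2 - e2).
have d2 : d ^+ 2 = h ^+ 2 - e2 by exact: sqrtCK.
have sum_rs : (h + d) + (h - d) = e1 by rewrite addrACA subrr addr0 /h; field.
have prod_rs : (h + d) * (h - d) = e2 by rewrite mulrC -subr_sqr d2 subKr.
have sumE : (n%:R - 2) * a * ((h + d) + (h - d)) = - ((n%:R - 1) * b).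
  by rewrite sum_rs /e1; field; rewrite a0 N2.
have prodE : (n%:R - 2) * a * ((h + d) * (h - d)) = n%:R * c.
  by rewrite prod_rs /e2; field; rewrite a0 N2.
have f_monic : f \is monic by apply: monic_quadrinomial; lia.
have sz : (size f).-1 = n by rewrite size_quadrinomial; lia.
have := prod_deriv_quadrinomial (ltnW hn) sumE prodE; rewrite -/f => prod_deriv.
have f_val x : f.[x] = x ^+ n + a * x ^+ 2 + b * x + c by rewrite !hornerE.
have := quadrinomial_values_prod n.-2 sumE prodE.
have -> : n.-2.+2 = n by lia.
(* Expanding exponent [n - 1] by [power_sum_pred] gives the same range and powers of [h] and [d] as
   exponent [n - 2], so the two sums merge into one. *)
rewrite -!f_val sum_rs prod_rs (power_sum_pred _ _ (ltn0Sn _)) exprD_plus_exprB d2.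
have -> : n.-2.+1 = n.-1 by lia.
move=> values_prod; rewrite -/h !subn1 !subn2.
(* [B] is the bracket of the statement. *)
set B := (X in _ = _ * X).
have B_values : n%:R ^+ 2 * (f.[h + d] * f.[h - d]) = e2 * B.
  rewrite values_prod; congr (_ * _); rewrite /B.
  have predE : n.-1%:R = n%:R - 1 :> R[i] by rewrite -subn1 natrB // (ltn_trans _ hn).
  set S0 := \sum_(0 <= i < _) _; set S1 := \sum_(0 <= i < _) _.
  set S := (X in _ = _ + _ * X).
  have -> : S = 4 * a * e2 * S0 + b * e1 * S1.
    rewrite /S !mulr_sumr -big_split; apply: eq_bigr => i _ /=.
    by rewrite predE; ring.
  have -> : e1 = 2 * h by rewrite /h; field.
  by ring.
rewrite monic_discriminant // sz bin2 -divn2 -!(mulrA ((-1) ^+ _)); congr (_ * _).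
(* Here [n^2] turns [f(r) f(s)] into [e2 * B], and [c] is the factor required by [prod_deriv]. Since
   [(n-2) a e2 = n c], this cancels [c] and one [n], which leaves [n^-1]. *)
apply: (mulfI (mulf_neq0 (expf_neq0 2 N0) c0)).
have e2E : (n%:R - 2) * a * e2 = n%:R * c by rewrite -prod_rs.
have -> : n%:R ^+ 2 * c * \prod_(z <- Defs.roots f) f^`().[z] =
    ((n%:R - 2) * a) ^+ n.-1 * ((n%:R - 2) * a * e2) * B.
  rewrite -mulrA prod_deriv -[_ ^+ n * _ * _]mulrA mulrCA B_values.
  have -> : ((n%:R - 2) * a) ^+ n = ((n%:R - 2) * a) ^+ n.-1 * ((n%:R - 2) * a).
    by rewrite -exprSr prednK // (ltn_trans _ hn).
  by rewrite !mulrA.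
rewrite e2E exprMn.
by field.
Qed.
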